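(* Let $r \geq 3$ be a fixed integer, let $p = p(n) \in [0,1]$, and let $d = d(n) = (n-(r-1))p$. If $d = \omega(1)$ (that is, $d \to \infty$ as $n \to \infty$), then with high probability $$\nu^{(r-1)}(H_r(n,p)) \sim \frac{1}{r}\binom{n}{r-1}.$$
   Context: An $r$-graph $G$ is a set of $r$-element subsets (edges) of a vertex set $V(G)$. An $(r-1)$-matching in $G$ is a set of edges of $G$ any two distinct members of which intersect in fewer than $r-1$ vertices; $\nu^{(r-1)}(G)$ is the maximum size of an $(r-1)$-matching in $G$. $H_r(n,p)$ denotes the random $r$-graph on a set $V$ of $n$ labelled vertices in which each $r$-element subset of $V$ is an edge with probability $p$, independently of the others; $d$ is the expected number of edges containing a given $(r-1)$-set. ''With high probability'' means with probability tending to $1$ as $n \to \infty$. $A \sim B$ means $A/B \to 1$ as $n \to \infty$; for random $A_n$, ''$A_n \sim B_n$ with high probability'' means that there is a deterministic sequence $\varepsilon_n \to 0$ such that $|A_n - B_n| \leq \varepsilon_n B_n$ holds with probability tending to $1$. *)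

(* Defs.v *)
From mathcomp Require Import all_boot all_order all_algebra.
From mathcomp Require Import all_classical all_reals all_analysis.

Set Implicit Arguments.
Unset Strict Implicit.
Unset Printing Implicit Defensive.
Import Order.TTheory GRing.Theory Num.Theory.
Import numFieldNormedType.Exports.

Local Open Scope ring_scope.

Section Matchings.
Variable T : finType.
Implicit Types G M : {set {set T}}.

Definition is_rgraph (r : nat) G : bool := [forall e in G, #|e| == r].

Definition is_matching (m : nat) G M : bool :=
  (M \subset G) &&
  [forall e in M, forall f in M, (e != f) ==> (#|e :&: f| < m)%N].

Definition nu (m : nat) G : nat :=
  (\max_(M : {set {set T}} | is_matching m G M) #|M|)%N.

End Matchings.

Section RandomGraph.
Variables (R : realType) (r n : nat) (p : R).

(* The law of H_r(n, p): the product, over all r-subsets e of the vertex set,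
   of the Bernoulli(p) laws of the events "e is an edge". *)
Definition Hrnp_mass (H : {set {set 'I_n}}) : R :=
  \prod_(e : {set 'I_n} | #|e| == r) (if e \in H then p else 1 - p).

Definition Hrnp_prob (A : pred {set {set 'I_n}}) : R :=
  \sum_(H : {set {set 'I_n}} | is_rgraph r H && A H) Hrnp_mass H.

(* The events "e is an edge" are mutually independent and of probability p;
   with A and B empty, the total mass is 1. *)
Lemma Hrnp_prob_indep (A B : {set {set 'I_n}}) :
    is_rgraph r A -> is_rgraph r B -> [disjoint A & B] ->
  Hrnp_prob (fun H => (A \subset H) && [disjoint B & H]) =
  p ^+ #|A| * (1 - p) ^+ #|B|.
Proof.
move=> /forall_inP/= Ar /forall_inP/= Br dAB; rewrite /Hrnp_prob big_mkcond /=.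
pose F (e : {set 'I_n}) : R :=
  if #|e| == r then if e \in B then 0 else p else 0.
pose G (e : {set 'I_n}) : R :=
  if #|e| == r then if e \in A then 0 else 1 - p else 1.
transitivity (\prod_e (F e + G e)).
  rewrite bigA_distr; apply: eq_bigr => H _; case: ifPn => [|nH].
    case/and3P=> /forall_inP/= Hr AH BH; rewrite /Hrnp_mass big_mkcond /=.
    apply: eq_bigr => e _; rewrite /F /G; case: ifP => er.
      case: ifPn => eH; first by rewrite (disjointFl BH eH).
      by rewrite (contraNF (fintype.subsetP AH e) eH).
    by case: ifPn => // /Hr; rewrite er.
  suff [e /eqP e0] : exists e, (if e \in H then F e else G e) == 0.
    by rewrite (bigD1 e) //= e0 mul0r.
  move: nH; rewrite !negb_and => /or3P[].
  - rewrite negb_forall => /existsP[e]; rewrite negb_imply => /andP[eH er].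
    by exists e; rewrite eH /F (negPf er).
  - case/fintype.subsetPn => e eA eH; exists e.
    by rewrite (negPf eH) /G Ar // eA.
  - rewrite -finset.setI_eq0 => /finset.set0Pn[e]; rewrite inE => /andP[eB eH].
    by exists e; rewrite eH /F Br // eB.
rewrite -!prodr_const [in RHS]big_mkcond [X in _ * X]big_mkcond -big_split /=.
apply: eq_bigr => e _; rewrite /F /G; case: (boolP (e \in A)) => eA.
  by rewrite Ar // (disjointFr dAB eA) addr0 mulr1.
case: (boolP (e \in B)) => eB; first by rewrite Br // add0r mul1r.
by case: ifP; rewrite ?add0r ?mulr1 // addrC subrK.
Qed.

End RandomGraph.

Definition whp (R : realType) (r : nat) (p : nat -> R)
    (A : forall n, pred {set {set 'I_n}}) : Prop :=
  (Hrnp_prob r (p n) (A n) @[n --> \oo] --> (1 : R))%classic.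

Definition whp_sim (R : realType) (r : nat) (p : nat -> R)
    (X : forall n, {set {set 'I_n}} -> R) (B : nat -> R) : Prop :=
  exists2 eps : nat -> R, (eps n @[n --> \oo] --> (0 : R))%classic
    & whp r p (fun n H => `|X n H - B n| <= eps n * B n).

(* Main.v *)
Require Import Defs.
From mathcomp Require Import all_boot all_order all_algebra.
From mathcomp Require Import all_classical all_reals all_analysis.
From mathcomp Require Import ring lra.
Import Order.TTheory GRing.Theory Num.Theory.
Import numFieldNormedType.Exports.
Local Open Scope ring_scope.

Set Implicit Arguments.
Unset Strict Implicit.
Unset Printing Implicit Defensive.

(** The facets of an r-set are its r subsets of size r-1, and an (r-1)-matching is
a set of edges with pairwise disjoint facet sets.  The bound
nu <= 'C(n, r-1) / r is therefore deterministic, so by Markov's inequality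
applied to the deficit it is enough that the mean of nu is asymptotically at
least 'C(n, r-1) / r ([bernoulli_mean_markov]); no concentration of nu enters.

The (r-1)-sets as vertices and the facet sets of all r-sets as hyperedges form
a regular linear hypergraph of degree d = n - (r-1).  For such a hypergraph we
show ([sparse_packing_mean]) that a random subset of the hyperedges of density
p contains on average a matching covering a proportion 1 - delta of the
vertices as soon as d p exceeds a constant C = C(r, delta).

The matching is the one found greedily when the hyperedges are revealed by
sprinkling, in many independent rounds of tiny density.  Keeping only what
happens in the rounds that reveal exactly one hyperedge gives a Markov chain on
the set U of uncovered vertices: each hyperedge contained in U is removed from
U with the same probability h.  [packing_mean_ge] bounds the mean matching
number below by the mean number of hyperedges which this chain removes.

The probability a(S) that a vertex set S is still uncovered obeys an exact
linear hierarchy: in one step a(S) decreases by the sum of h a(S :|: e) over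
the hyperedges e that meet S.  By linearity of the hypergraph almost all the
#|S| d relevant hyperedges meet S in a single vertex, so that the hierarchy is
nearly solved by the product f ^ #|S| where f' = f - h d f^r, that is, the
vertices behave as if they were independent.  The error is controlled by a bound
of the form eps y ^ #|S| valid for all S simultaneously: it propagates when
y grows by y' = y + h d y^r ([hierarchy_step]).  This y blows up in finite
time, so the time is cut into short stages in each of which y goes from 4 to at
most 16 ([surv_stage]).  Between two stages y is reset to 4 at the cost of
replacing eps by its square root, because the error is also at most 1
([surv_approx]).  Finally f tends to 0 with time ([decay_small]). *)

(** * The random greedy matching as a Markov chain on vertex sets *)

Section Greedy.
Variables (R : realFieldType) (I X : finType) (F : I -> {set X}) (G : {set I}).

(** The transition operator of the chain which, for each edge F i contained in
    the current set U of uncovered vertices, moves to U :\: F i with probability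
    h, and which otherwise stays at U. *)
Definition greedy_step (h : R) (phi : {set X} -> R) (U : {set X}) : R :=
  phi U + h * \sum_(i in G | F i \subset U) (phi (U :\: F i) - phi U).

(** The probability that S is contained in the state after j steps of the chain
    started at U, for h #|G| <= 1.  It is introduced through the recursion on S
    which the error analysis uses; [surv_stepE] identifies it with an iterate of
    the transition operator. *)
Fixpoint surv (h : R) (j : nat) (S U : {set X}) : R :=
  if j is j'.+1 then
    surv h j' S U - h * \sum_(i in G | ~~ [disjoint F i & S]) surv h j' (S :|: F i) U
  else (S \subset U)%:R.

Lemma eq_greedy_step h phi psi :
  phi =1 psi -> greedy_step h phi =1 greedy_step h psi.
Proof.
move=> e U; rewrite /greedy_step e; congr (_ + _ * _).
by apply: eq_bigr => i _; rewrite !e.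
Qed.

Lemma greedy_step_sum h c (J : finType) (P : pred J) phi (f : J -> {set X} -> R) U :
  greedy_step h (fun U => phi U + c * \sum_(i | P i) f i U) U =
  greedy_step h phi U + c * \sum_(i | P i) greedy_step h (f i) U.
Proof.
rewrite /greedy_step.
under [X in _ + h * X = _]eq_bigr do rewrite opprD addrACA -mulrBr -sumrB.
rewrite !big_split /= -!mulr_sumr exchange_big /=; ring.
Qed.

(** Removing F i from U destroys the inclusion of S exactly when F i meets S and
    S :|: F i was contained in U; this is the case j = 0, and the operator is
    linear. *)
Lemma surv_stepE h j S U : surv h j.+1 S U = greedy_step h (surv h j S) U.
Proof.
elim: j S U => [|j IH] S U.
  rewrite /= /greedy_step -mulrN -sumrN; congr (_ + _ * _).
  rewrite [LHS]big_mkcondr [RHS]big_mkcondr /=; apply: eq_bigr => i _.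
  rewrite finset.subsetD finset.subUset disjoint_sym.
  by case: (F i \subset U); case: [disjoint _ & _]; case: (S \subset U);
    rewrite /= ?subrr ?oppr0 ?sub0r ?subr0.
transitivity (greedy_step h (surv h j S) U + (- h) *
   \sum_(i in G | ~~ [disjoint F i & S]) greedy_step h (surv h j (S :|: F i)) U).
  rewrite mulNr -IH; congr (_ - _ * _).
  by apply: eq_bigr => i _; rewrite -IH.
rewrite -greedy_step_sum; apply: eq_greedy_step => V /=.
by rewrite mulNr.
Qed.

(** The total jump rate out of a state is at most h #|G|, so under h #|G| <= 1
    the operator averages with nonnegative weights. *)
Lemma greedy_step_le h phi psi : 0 <= h -> h * #|G|%:R <= 1 ->
  (forall U, phi U <= psi U) ->
  forall U, greedy_step h phi U <= greedy_step h psi U.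
Proof.
move=> h0 hG le U; rewrite /greedy_step -subr_ge0.
have -> : psi U + h * \sum_(i in G | F i \subset U) (psi (U :\: F i) - psi U) -
   (phi U + h * \sum_(i in G | F i \subset U) (phi (U :\: F i) - phi U)) =
   (psi U - phi U) * (1 - h * #|[set i in G | F i \subset U]|%:R) +
   h * \sum_(i in G | F i \subset U) (psi (U :\: F i) - phi (U :\: F i)).
  have cst (c : R) : \sum_(i in G | F i \subset U) c =
      c * #|[set i in G | F i \subset U]|%:R.
    by rewrite -big_set /= sumr_const mulr_natr.
  rewrite !sumrB !cst; ring.
rewrite addr_ge0// ?mulr_ge0 ?subr_ge0 ?sumr_ge0// => [|i _]; last first.
  by rewrite subr_ge0.
apply: le_trans hG; rewrite ler_wpM2l// ler_nat subset_leq_card//.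
by apply/fintype.subsetP => i; rewrite inE => /andP[].
Qed.

Lemma greedy_step_cst h c U : greedy_step h (fun=> c) U = c.
Proof. by rewrite /greedy_step big1 ?mulr0 ?addr0// => i _; rewrite subrr. Qed.

Lemma surv01 h j S U : 0 <= h -> h * #|G|%:R <= 1 -> 0 <= surv h j S U <= 1.
Proof.
move=> h0 hG; elim: j U => [|j IH] U; first by rewrite /= ler0n lern1; case: (_ \subset _).
rewrite surv_stepE -(greedy_step_cst h 0 U) -[X in _ && (_ <= X)](greedy_step_cst h 1 U).
by apply/andP; split; apply: greedy_step_le => // V; case/andP: (IH V).
Qed.

End Greedy.

(** * Inequalities for powers *)

Section PowerBounds.
Variable R : realFieldType.
Implicit Types x f y t : R.

Lemma bernoulli_ge x k : -1 <= x -> 1 + k%:R * x <= (1 + x) ^+ k.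
Proof.
move=> x1; elim: k => [|k IH]; first by rewrite mul0r addr0 expr0.
rewrite exprSr; apply: le_trans (ler_wpM2r _ IH); last by lra.
have : 0 <= k%:R * x ^+ 2 by rewrite mulr_ge0 ?sqr_ge0.
rewrite -natr1; lra.
Qed.

Lemma bernoulli_le x k : 0 <= x <= 1 ->
  (1 - x) ^+ k <= 1 - k%:R * x + k%:R ^+ 2 * x ^+ 2.
Proof.
move=> /andP[x0 x1]; elim: k => [|k IH]; first by rewrite expr0; lra.
rewrite exprSr; apply: le_trans (ler_wpM2r _ IH) _; first by lra.
have : 0 <= k%:R ^+ 2 * x ^+ 3 by rewrite mulr_ge0 ?sqr_ge0 ?exprn_ge0.
have : 0 <= k%:R * x ^+ 2 by rewrite mulr_ge0 ?sqr_ge0.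
have := sqr_ge0 x; rewrite -natr1; lra.
Qed.

(** One step of f' = f - t f^(r+1) moves the k-th power by the k-fold first-
    order term that the hierarchy requires, up to a second-order error. *)
Lemma decay_expand f t r k : 0 <= f <= 1 -> 0 <= t <= 1 ->
  `|(f - t * f ^+ r.+1) ^+ k - f ^+ k + k%:R * t * f ^+ (k + r)|
     <= k%:R ^+ 2 * t ^+ 2.
Proof.
move=> /andP[f0 f1] /andP[t0 t1]; set x := t * f ^+ r.
have x01 : 0 <= x <= 1 by rewrite mulr_ge0 ?exprn_ge0 //= mulr_ile1 ?exprn_ge0 ?exprn_ile1.
have -> : f - t * f ^+ r.+1 = f * (1 - x) by rewrite exprS /x; ring.
have -> : k%:R * t * f ^+ (k + r) = f ^+ k * (k%:R * x) by rewrite exprD /x; ring.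
rewrite exprMn -[X in _ - X]mulr1 -mulrBr -mulrDr normrM ger0_norm ?exprn_ge0//.
have ge : 0 <= (1 - x) ^+ k - 1 + k%:R * x.
  by have := @bernoulli_ge (- x) k ltac:(lra); lra.
rewrite (ger0_norm ge); apply: (@le_trans _ _ (1 * (k%:R ^+ 2 * x ^+ 2))).
  rewrite ler_pM ?exprn_ge0 ?exprn_ile1//.
  by have := bernoulli_le k x01; lra.
rewrite mul1r ler_wpM2l ?sqr_ge0// lerXn2r ?nnegrE//; first by case/andP: x01.
by rewrite /x ler_piMr // exprn_ile1.
Qed.

(** This inequality makes y^k, with y' = y + t y^(r+1), a supersolution of the
    linear hierarchy for all k at once. *)
Lemma growth_expand y t r k : 0 <= y -> 0 <= t ->
  y ^+ k + k%:R * t * y ^+ (k + r) <= (y + t * y ^+ r.+1) ^+ k.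
Proof.
move=> y0 t0; have -> : y + t * y ^+ r.+1 = y * (1 + t * y ^+ r) by rewrite exprS; ring.
rewrite exprMn exprD.
have -> : y ^+ k + k%:R * t * (y ^+ k * y ^+ r) = y ^+ k * (1 + k%:R * (t * y ^+ r)).
  by ring.
rewrite ler_wpM2l ?exprn_ge0 ?bernoulli_ge//.
by apply: le_trans (mulr_ge0 t0 (exprn_ge0 r y0)); lra.
Qed.

Lemma sqr_le_expr4 y k : 4 <= y -> k%:R ^+ 2 <= y ^+ k.
Proof.
move=> y4; apply: (@le_trans _ _ (4 ^+ k)); last first.
  by rewrite lerXn2r ?nnegrE//; lra.
rewrite -!natrX ler_nat (_ : 4 = 2 ^ 2)%N// -expnM mulnC expnM leq_exp2r//.
exact/ltnW/ltn_expl.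
Qed.

End PowerBounds.

(** * Asymptotic independence of the uncovered vertices: one step *)

(** For the facets of r-sets the last condition (linearity) holds since two
    distinct (r-1)-sets are contained in at most one r-set. *)
Definition regular_linear (I X : finType) (F : I -> {set X}) (G : {set I})
    (D : {set X}) (r d : nat) : Prop :=
  [/\ forall i, i \in G -> F i \subset D,
      forall i, i \in G -> #|F i| = r,
      forall x, x \in D -> #|[set i in G | x \in F i]| = d &
      forall x y, x \in D -> y \in D -> x != y ->
        (#|[set i in G | (x \in F i) && (y \in F i)]| <= 1)%N].

Section Hierarchy.
Variables (R : realFieldType) (I X : finType) (F : I -> {set X}).
Variables (G : {set I}) (D : {set X}) (r d : nat).
Hypothesis lin : regular_linear F G D r.+1 d.
Let FD : forall i, i \in G -> F i \subset D := let: And4 H _ _ _ := lin in H.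
Let F_card : forall i, i \in G -> #|F i| = r.+1 := let: And4 _ H _ _ := lin in H.
Let F_deg : forall x, x \in D -> #|[set i in G | x \in F i]| = d :=
  let: And4 _ _ H _ := lin in H.
Let F_codeg : forall x y, x \in D -> y \in D -> x != y ->
    (#|[set i in G | (x \in F i) && (y \in F i)]| <= 1)%N :=
  let: And4 _ _ _ H := lin in H.

(** Double counting of the pairs formed by a vertex of S and an edge at it. *)
Lemma touching_sum (b : I -> R) (S : {set X}) :
  \sum_(i in G | ~~ [disjoint F i & S]) b i =
  \sum_(x in S) \sum_(i in G | x \in F i) b i / #|F i :&: S|%:R.
Proof.
rewrite (exchange_big_dep (mem G)) /= => [|x i]; last by move=> _ /andP[].
rewrite big_mkcondr /=; apply: eq_bigr => i iG.
transitivity (\sum_(x in F i :&: S) b i / #|F i :&: S|%:R); last first.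
  by apply: eq_bigl => x; rewrite inE iG /= andbC.
rewrite sumr_const -finset.setI_eq0 -cards_eq0; case: eqP => [->//|/eqP m0 /=].
by rewrite -[RHS]mulr_natr divfK// pnatr_eq0.
Qed.

(** By linearity each other vertex of S lies on at most one edge through x. *)
Lemma card_multi_touch (S : {set X}) x : S \subset D -> x \in S ->
  (#|[set i in G | (x \in F i) && (#|F i :&: S| != 1)]| <= #|S|)%N.
Proof.
move=> SD xS; apply: (@leq_trans
  #|\bigcup_(y in S :\ x) [set i in G | (x \in F i) && (y \in F i)]|).
  apply/subset_leq_card/fintype.subsetP => i; rewrite inE => /and3P[iG xi m1].
  have xin : x \in F i :&: S by rewrite inE xi.
  have [y] : exists y, y \in (F i :&: S) :\ x.
    apply/finset.set0Pn; rewrite -cards_eq0; apply: contra m1 => /eqP c0.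
    by rewrite (cardsD1 x) xin c0.
  rewrite !inE => /and3P[yx yi yS].
  by apply/finset.bigcupP; exists y; rewrite !inE ?yx ?iG ?xi.
apply: (@leq_trans (\sum_(y in S :\ x) 1)%N); last first.
  by rewrite sum1_card subset_leq_card // finset.subD1set.
apply: (@leq_trans (\sum_(y in S :\ x) #|[set i in G | (x \in F i) && (y \in F i)]|)%N).
  apply: (big_ind2 (fun A n => #|A : {set I}| <= n)%N) => [|A a B b|].
    by rewrite cards0.
    by move=> Aa Bb; apply: leq_trans (leq_card_setU _ _) (leq_add Aa Bb).
  by [].
apply: leq_sum => y; rewrite !inE => /andP[yx yS].
by rewrite F_codeg ?(fintype.subsetP SD)// eq_sym.
Qed.

Section Step.
Variables (a : {set X} -> R) (f h eps y : R).
Hypothesis a01 : forall S : {set X}, 0 <= a S <= 1.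
Hypothesis f01 : 0 <= f <= 1.
Hypothesis h0 : 0 <= h.
Hypothesis hd1 : h * d%:R <= 1.
Hypothesis eps0 : 0 <= eps.
Hypothesis y4 : 4 <= y.
Hypothesis a_f : forall S : {set X}, S \subset D -> `|a S - f ^+ #|S| | <= eps * y ^+ #|S|.

(** An edge which meets S in one vertex enlarges S by exactly r vertices, so the
    assumed bound applies to S :|: F i; for the other edges only the trivial
    bound 1 is available. *)
Lemma touching_edge_error (S : {set X}) x i : S \subset D -> x \in S ->
  i \in G -> x \in F i ->
  `|a (S :|: F i) / #|F i :&: S|%:R - f ^+ (#|S| + r)|
    <= eps * y ^+ (#|S| + r) + (#|F i :&: S| != 1)%:R.
Proof.
move=> SD xS iG xi; have [m1|m1] /= := eqVneq #|F i :&: S| 1%N.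
  rewrite m1 divr1 addr0; have cU : #|S :|: F i| = (#|S| + r)%N.
    by rewrite cardsU finset.setIC m1 F_card// addnS subn1.
  by rewrite -cU a_f// finset.subUset SD FD.
have c0 : (0 < #|F i :&: S|)%N.
  by apply/card_gt0P; exists x; rewrite inE xi.
have /andP[A0 A1] : 0 <= a (S :|: F i) / #|F i :&: S|%:R <= 1.
  have /andP[b0 b1] := a01 (S :|: F i).
  rewrite divr_ge0//= ler_pdivrMr ?ltr0n// mul1r (le_trans b1)// ler1n.
  exact: c0.
have /andP[f0 f1] := f01.
have fk0 := exprn_ge0 (#|S| + r) f0; have fk1 := exprn_ile1 (#|S| + r) f0 f1.
have : 0 <= eps * y ^+ (#|S| + r).
  by rewrite mulr_ge0 ?exprn_ge0//; apply: le_trans y4; rewrite ler0n.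
rewrite ler_norml; lra.
Qed.

Lemma touching_sum_error (S : {set X}) : S \subset D ->
  `|\sum_(i in G | ~~ [disjoint F i & S]) a (S :|: F i)
     - #|S|%:R * d%:R * f ^+ (#|S| + r)|
    <= #|S|%:R * d%:R * (eps * y ^+ (#|S| + r)) + #|S|%:R ^+ 2.
Proof.
move=> SD; set k := #|S|; rewrite touching_sum.
have -> : k%:R * d%:R * f ^+ (k + r) =
    \sum_(x in S) \sum_(i in G | x \in F i) f ^+ (k + r).
  under eq_bigr => x xS.
    rewrite -big_set /= sumr_const F_deg ?(fintype.subsetP SD)//; over.
  by rewrite /= sumr_const -[RHS]mulr_natl -[f ^+ _ *+ d]mulr_natl -mulrA.
have -> : k%:R * d%:R * (eps * y ^+ (k + r)) + k%:R ^+ 2 =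
    \sum_(x in S) (d%:R * (eps * y ^+ (k + r)) + k%:R).
  by rewrite sumr_const -[RHS]mulr_natl -/k; ring.
rewrite -sumrB; apply: le_trans (ler_norm_sum _ _ _) _.
apply: ler_sum => x xS; rewrite -sumrB; apply: le_trans (ler_norm_sum _ _ _) _.
apply: (@le_trans _ _ (\sum_(i in G | x \in F i)
    (eps * y ^+ (k + r) + (#|F i :&: S| != 1)%:R))).
  apply: ler_sum => i /andP[iG xi]. exact: (touching_edge_error SD xS).
rewrite big_split /= lerD//.
  by rewrite -big_set /= sumr_const F_deg ?(fintype.subsetP SD)// mulr_natl.
rewrite -natr_sum ler_nat; apply: leq_trans (card_multi_touch SD xS).
rewrite -sum1dep_card big_mkcondr [leqRHS]big_mkcondr /=.
by apply: leq_sum => i _; case: (x \in F i).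
Qed.

(** The errors coming from the edges that meet S several times and from the
    second-order terms are at most #|S|^2 (h + (h d)^2), and #|S|^2 is absorbed
    by y^#|S| since y >= 4. *)
Lemma hierarchy_step (S : {set X}) : S \subset D ->
  `|a S - h * \sum_(i in G | ~~ [disjoint F i & S]) a (S :|: F i)
     - (f - h * d%:R * f ^+ r.+1) ^+ #|S| |
    <= (eps + (h + (h * d%:R) ^+ 2)) * (y + h * d%:R * y ^+ r.+1) ^+ #|S|.
Proof.
move=> SD; set t := h * d%:R; set k := #|S|.
have t0 : 0 <= t by rewrite mulr_ge0.
have y0 : 0 <= y by apply: le_trans y4; rewrite ler0n.
have E1 := a_f SD; have E2 := touching_sum_error SD.
have E3 : `|(f - t * f ^+ r.+1) ^+ k - f ^+ k + k%:R * t * f ^+ (k + r)|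
     <= k%:R ^+ 2 * t ^+ 2 by apply: decay_expand; rewrite ?t0.
have E4 : y ^+ k + k%:R * t * y ^+ (k + r) <= (y + t * y ^+ r.+1) ^+ k.
  exact: growth_expand.
have E5 : k%:R ^+ 2 <= (y + t * y ^+ r.+1) ^+ k.
  apply: sqr_le_expr4; apply: (le_trans y4).
  by rewrite lerDl mulr_ge0 ?exprn_ge0.
move: E1 E2; rewrite -/k; set A := \sum_(i in G | _) _ => E1 E2.
have E2' : `|h * (A - k%:R * d%:R * f ^+ (k + r))| <=
   h * (k%:R * d%:R * (eps * y ^+ (k + r)) + k%:R ^+ 2).
  by rewrite normrM ger0_norm// ler_wpM2l.
have E4' := ler_wpM2l eps0 E4.
have E5' : (h + t ^+ 2) * k%:R ^+ 2 <= (h + t ^+ 2) * (y + t * y ^+ r.+1) ^+ k.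
  by rewrite ler_wpM2l ?addr_ge0 ?sqr_ge0.
move: E1 E2' E3; rewrite !ler_norml.
have -> : h * (A - k%:R * d%:R * f ^+ (k + r)) = h * A - k%:R * t * f ^+ (k + r).
  by rewrite /t; ring.
have -> : h * (k%:R * d%:R * (eps * y ^+ (k + r)) + k%:R ^+ 2) =
  eps * (k%:R * t * y ^+ (k + r)) + h * k%:R ^+ 2 by rewrite /t; ring.
move: E4' E5'; rewrite [in eps * (_ + _)]mulrDr !mulrDl; lra.
Qed.

End Step.
End Hierarchy.

(** * Asymptotic independence of the uncovered vertices: many steps *)

Section Decay.
Variables (R : realFieldType) (r : nat) (t : R).
Hypothesis t01 : 0 <= t <= 1.

(** The idealized probability that a given vertex is uncovered after j steps: it
    is then lost at rate t, provided that the r other vertices of an edge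
    through it are also uncovered. *)
Definition decay (j : nat) : R := iter j (fun f => f - t * f ^+ r.+1) 1.

Lemma decayS j : decay j.+1 = decay j - t * decay j ^+ r.+1.
Proof. by []. Qed.

Lemma decay01 j : 0 <= decay j <= 1.
Proof.
have /andP[t0 t1] := t01.
elim: j => [|j]; first by rewrite ler01 lexx.
rewrite decayS; set f := decay j => /andP[f0 f1].
have fr0 := exprn_ge0 r.+1 f0; have tf0 := mulr_ge0 t0 fr0.
have : t * f ^+ r.+1 <= f.
  rewrite -[leRHS]mul1r ler_pM// exprS ler_piMr ?exprn_ile1//.
by lra.
Qed.

(** While f exceeds delta it loses at least t delta^(r+1) in each step. *)
Lemma decay_small (delta : R) j : 0 <= delta -> 1 <= j%:R * (t * delta ^+ r.+1) ->
  decay j <= delta.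
Proof.
move=> d0 j1; have [t0 _] := andP t01.
suff : decay j <= delta \/ decay j <= 1 - j%:R * (t * delta ^+ r.+1).
  by case=> // le; apply: le_trans d0; lra.
elim: j {j1} => [|j IH]; first by right; rewrite mul0r subr0.
have /andP[f0 f1] := decay01 j; have tf0 := mulr_ge0 t0 (exprn_ge0 r.+1 f0).
have [lt|ge] := lerP (decay j) delta; first by left; rewrite decayS; lra.
case: IH => [|IH]; first by move=> /(lt_le_trans ge); rewrite ltxx.
right; have : t * delta ^+ r.+1 <= t * decay j ^+ r.+1.
  by rewrite ler_wpM2l// lerXn2r ?nnegrE// ltW.
by rewrite decayS -natr1 mulrDl mul1r; lra.
Qed.

End Decay.

Section Tolerance.
Variable R : realFieldType.

(** The noise which each of Q stages may add for a final accuracy e: a stage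
    that starts with accuracy e^2 / 2 and adds at most e^2 / 2 ends with
    accuracy e. *)
Fixpoint tolerance (Q : nat) (e : R) : R :=
  if Q is Q'.+1 then Num.min (e ^+ 2 / 2) (tolerance Q' (e ^+ 2 / 2)) else 1.

Lemma tolerance_gt0 Q e : 0 < e -> 0 < tolerance Q e.
Proof.
elim: Q e => [|Q IH] e e0 //=.
by rewrite lt_min IH ?andbT divr_gt0 ?exprn_gt0.
Qed.

End Tolerance.

Section Stages.
Variables (R : realFieldType) (I X : finType) (F : I -> {set X}).
Variables (G : {set I}) (D : {set X}) (r d : nat).
Hypothesis lin : regular_linear F G D r.+1 d.
Variables (h : R) (J : nat).
Let t := h * d%:R.
Hypothesis h0 : 0 <= h.
Hypothesis hG : h * #|G|%:R <= 1.
Hypothesis t1 : t <= 1.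
Hypothesis J_short : J%:R * (t * 16 ^+ r.+1) <= 12.

(** Iterating [hierarchy_step] with y growing linearly; the growth rate t
    16^(r+1) suffices as long as y <= 16, which [J_short] guarantees. *)
Lemma surv_stage eps j0 j : 0 <= eps -> (j <= J)%N ->
  (forall S : {set X}, S \subset D ->
     `|surv F G h j0 S D - decay r t j0 ^+ #|S| | <= eps * 4 ^+ #|S|) ->
  forall S : {set X}, S \subset D ->
     `|surv F G h (j0 + j) S D - decay r t (j0 + j) ^+ #|S| |
       <= (eps + j%:R * (h + t ^+ 2)) * (4 + j%:R * (t * 16 ^+ r.+1)) ^+ #|S|.
Proof.
move=> eps0 jJ init.
have t0 : 0 <= t by rewrite mulr_ge0.
have c0 : 0 <= t * 16 ^+ r.+1 by rewrite mulr_ge0 ?exprn_ge0.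
have b0 : 0 <= h + t ^+ 2 by rewrite addr_ge0 ?exprn_ge0.
elim: j jJ => [|j IH] jJ S SD; first by rewrite addn0 !mul0r !addr0; apply: init.
set y := 4 + j%:R * (t * 16 ^+ r.+1).
have y4 : 4 <= y by rewrite lerDl mulr_ge0.
have y0 : 0 <= y by apply: le_trans y4; rewrite ler0n.
have y16 : y <= 16.
  have : j%:R * (t * 16 ^+ r.+1) <= J%:R * (t * 16 ^+ r.+1).
    by rewrite ler_wpM2r// ler_nat ltnW.
  by move: J_short; rewrite /y; lra.
have := @hierarchy_step R I X F G D r d lin
  (fun S => surv F G h (j0 + j) S D) (decay r t (j0 + j)) h
  (eps + j%:R * (h + t ^+ 2)) y (fun S => surv01 F (j0 + j) S D h0 hG)
  _ h0 t1 _ y4 (IH (ltnW jJ)) S SD.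
rewrite addnS /= -/(decay _ _ _) => H; apply: le_trans (H _ _) _.
- by apply: decay01; rewrite t0.
- by rewrite addr_ge0// mulr_ge0.
have S_split u v : u + j.+1%:R * v = u + j%:R * v + v.
  by rewrite -natr1 mulrDl mul1r addrA.
rewrite !S_split addrA -/y ler_wpM2l ?addr_ge0 ?mulr_ge0//.
rewrite lerXn2r ?nnegrE ?addr_ge0 ?mulr_ge0 ?exprn_ge0// lerD2l ler_wpM2l//.
by rewrite lerXn2r ?nnegrE.
Qed.

(** At the end of a stage the error is at most e^2 16^k = (e 4^k)^2, and at most
    1, hence at most e 4^k: the next stage can start again from y = 4. *)
Lemma surv_approx Q e : 0 < e -> J%:R * (h + t ^+ 2) <= tolerance Q e ->
  forall S : {set X}, S \subset D ->
   `|surv F G h (Q * J) S D - decay r t (Q * J) ^+ #|S| | <= e * 4 ^+ #|S|.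
Proof.
have t0 : 0 <= t by rewrite mulr_ge0.
have b0 : 0 <= h + t ^+ 2 by rewrite addr_ge0 ?exprn_ge0.
elim: Q e => [|Q IH] e e0 /= tol S SD.
  by rewrite /= SD expr1n subrr normr0 mulr_ge0 ?exprn_ge0 ?ltW.
move: tol; rewrite le_min => /andP[tol1 tol2].
have e20 : 0 < e ^+ 2 / 2 by rewrite divr_gt0 ?exprn_gt0.
have := surv_stage (ltW e20) (leqnn J) (IH _ e20 tol2) SD.
rewrite mulSn ![(J + _)%N]addnC; set err := `|_|; set k := #|S| => le1.
have le2 : err <= (e * 4 ^+ k) ^+ 2.
  have -> : (e * 4 ^+ k) ^+ 2 = e ^+ 2 * (4 ^+ 2) ^+ k by rewrite exprMn exprAC.
  apply: le_trans le1 _; rewrite ler_pM ?exprn_ge0 ?addr_ge0 ?mulr_ge0 ?(ltW e0)//.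
  - by rewrite [leRHS]splitr lerD2l.
  - rewrite lerXn2r ?nnegrE ?addr_ge0 ?mulr_ge0 ?exprn_ge0//.
    by apply: le_trans (lerD (lexx _) J_short) _; rewrite expr2; lra.
have [ge|lt] := lerP 1 (e * 4 ^+ k).
  apply: le_trans ge; rewrite /err ler_norml.
  have /andP[a0 a1] := surv01 F (Q * J + J) S D h0 hG.
  have /andP[f0 f1] : 0 <= decay r t (Q * J + J) <= 1 by apply: decay01; rewrite t0.
  have := exprn_ge0 k f0; have := exprn_ile1 k f0 f1; rewrite -/k; lra.
apply: (le_trans le2); rewrite expr2 ler_piMl ?mulr_ge0 ?exprn_ge0 ?(ltW e0) ?(ltW lt)//.
Qed.

End Stages.

(** * Binomial random subsets and sprinkling *)

Section RandomSubset.
Variables (R : realFieldType) (I : finType).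
Implicit Types (G H A B : {set I}) (p q : R) (phi psi : {set I} -> R).

(** The mean of phi over the random subset of G that contains each element
    independently with probability p. *)
Definition bernoulli_mean G p phi : R :=
  \sum_(H : {set I} | H \subset G)
    (\prod_(i in G) (if i \in H then p else 1 - p)) * phi H.

Lemma eq_bernoulli_mean G p phi psi :
  phi =1 psi -> bernoulli_mean G p phi = bernoulli_mean G p psi.
Proof. by move=> e; apply: eq_bigr => H _; rewrite e. Qed.

Lemma bernoulli_mean0 p phi : bernoulli_mean finset.set0 p phi = phi finset.set0.
Proof.
rewrite /bernoulli_mean (big_pred1 finset.set0) => [|H]; last exact: finset.subset0.
by rewrite big_set0 mul1r.
Qed.

Lemma bernoulli_meanU1 G x p phi : x \notin G ->
  bernoulli_mean (x |: G) p phi =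
  p * bernoulli_mean G p (fun H => phi (x |: H)) + (1 - p) * bernoulli_mean G p phi.
Proof.
move=> xG; rewrite /bernoulli_mean (bigID (fun H : {set I} => x \in H)) /=.
have in_ne i : i \in G -> i != x by move=> iG; apply: contraNneq xG => <-.
congr (_ + _); rewrite mulr_sumr; last first.
  apply: eq_big => [H|H /andP[HG xH]]; last first.
    by rewrite big_setU1//= (negPf xH) mulrA.
  apply/andP/idP => [[HG xH]|HG]; last first.
    rewrite (fintype.subset_trans HG (finset.subsetUr _ _)) (contra _ xG)//.
    exact: fintype.subsetP.
  apply/fintype.subsetP => i iH; have := fintype.subsetP HG i iH.
  by rewrite !inE => /orP[/eqP ix|//]; rewrite -ix iH in xH.
rewrite (reindex_onto (fun H => x |: H) (fun H => H :\ x)) /=; last first.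
  by move=> H /andP[_ xH]; rewrite finset.setD1K.
apply: eq_big => [H|H /andP[_ /eqP HE]].
  rewrite setU11 andbT; apply/andP/idP => [[HG /eqP HE]|HG].
    have xH : x \notin H by rewrite -HE !inE eqxx.
    apply/fintype.subsetP => i iH; have := fintype.subsetP HG i.
    rewrite !inE iH orbT => /(_ isT)/orP[/eqP ix|//].
    by rewrite -ix iH in xH.
  by rewrite finset.setUS//= finset.setU1K// (contra _ xG)//; apply: fintype.subsetP.
rewrite big_setU1//= setU11 -!mulrA; congr (_ * (_ * _)).
by apply: eq_bigr => i /in_ne ix; rewrite !inE (negPf ix).
Qed.

Lemma set_ind_U1 (P : {set I} -> Prop) : P finset.set0 ->
  (forall x G, x \notin G -> P G -> P (x |: G)) -> forall G, P G.
Proof.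
move=> P0 PU G; have [n] := ubnP #|G|; elim: n G => // n IH G.
have [->//|[x xG]] := finset.set_0Vmem G.
rewrite (cardsD1 x) xG add1n ltnS => Gn; rewrite -(finset.setD1K xG).
by apply: PU; [rewrite !inE eqxx|apply: IH].
Qed.

Lemma bernoulli_meanD G p phi psi :
  bernoulli_mean G p (fun H => phi H + psi H) =
  bernoulli_mean G p phi + bernoulli_mean G p psi.
Proof. by rewrite -big_split /=; apply: eq_bigr => H _; rewrite mulrDr. Qed.

Lemma bernoulli_meanZ G p c phi :
  bernoulli_mean G p (fun H => c * phi H) = c * bernoulli_mean G p phi.
Proof. by rewrite mulr_sumr; apply: eq_bigr => H _; rewrite mulrCA. Qed.

Lemma bernoulli_mean_sum G p (J : finType) (P : pred J) (f : J -> {set I} -> R) :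
  bernoulli_mean G p (fun H => \sum_(j | P j) f j H) =
  \sum_(j | P j) bernoulli_mean G p (f j).
Proof.
by rewrite exchange_big /=; apply: eq_bigr => H _; rewrite mulr_sumr.
Qed.

Lemma bernoulli_mean_cst G p c : bernoulli_mean G p (fun=> c) = c.
Proof.
elim/set_ind_U1: G => [|x G xG IH]; first exact: bernoulli_mean0.
by rewrite bernoulli_meanU1// IH -mulrDl addrC subrK mul1r.
Qed.

Lemma bernoulli_weight_ge0 G H p : 0 <= p <= 1 ->
  0 <= \prod_(i in G) (if i \in H then p else 1 - p).
Proof.
by move=> /andP[p0 p1]; apply: prodr_ge0 => i _; case: ifP; rewrite ?subr_ge0.
Qed.

Lemma bernoulli_mean_le G p phi psi : 0 <= p <= 1 ->
  (forall H, H \subset G -> phi H <= psi H) ->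
  bernoulli_mean G p phi <= bernoulli_mean G p psi.
Proof.
by move=> p01 le; apply: ler_sum => H HG; rewrite ler_wpM2l ?bernoulli_weight_ge0 ?le.
Qed.

(** The union of independent random subsets of densities p and q is a random
    subset of density p + q - p q. *)
Lemma bernoulli_mean_union G p q phi :
  bernoulli_mean G (p + q - p * q) phi =
  bernoulli_mean G p (fun A => bernoulli_mean G q (fun B => phi (A :|: B))).
Proof.
elim/set_ind_U1: G phi => [|x G xG IH] phi.
  by rewrite !bernoulli_mean0 finset.setU0.
rewrite bernoulli_meanU1// bernoulli_meanU1// !IH.
have split A : bernoulli_mean (x |: G) q (fun B => phi (A :|: B)) =
   q * bernoulli_mean G q (fun B => phi (x |: (A :|: B))) +
   (1 - q) * bernoulli_mean G q (fun B => phi (A :|: B)).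
  rewrite bernoulli_meanU1//; congr (_ * _ + _).
  by apply: eq_bernoulli_mean => B; rewrite finset.setUCA.
have splitx A : bernoulli_mean (x |: G) q (fun B => phi (x |: A :|: B)) =
   bernoulli_mean G q (fun B => phi (x |: (A :|: B))).
  rewrite split [X in q * X](eq_bernoulli_mean _ _ (_ : _ =1 fun B => phi (x |: (A :|: B)))).
    rewrite [X in _ + _ * X](eq_bernoulli_mean _ _ (_ : _ =1 fun B => phi (x |: (A :|: B)))).
      by rewrite -mulrDl addrC subrK mul1r.
    by move=> B; rewrite -finset.setUA.
  by move=> B; rewrite -finset.setUA finset.setUA finset.setUid.
rewrite (eq_bernoulli_mean _ _ splitx) (eq_bernoulli_mean _ _ split).
rewrite bernoulli_meanD !bernoulli_meanZ; ring.
Qed.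

(** Sprinkle a second random subset of density q, and keep only the outcomes
    where it is a singleton; each singleton has probability q (1 - q)^(#|G| -
    1), and by monotonicity the other outcomes do not decrease phi. *)
Lemma bernoulli_mean_sprinkle G p q phi : 0 <= p <= 1 -> 0 <= q <= 1 ->
  (forall A B, A \subset B -> phi A <= phi B) ->
  bernoulli_mean G p phi + q * (1 - q) ^+ #|G|.-1 *
    \sum_(i in G) (bernoulli_mean G p (fun H => phi (i |: H)) - bernoulli_mean G p phi)
  <= bernoulli_mean G (p + q - p * q) phi.
Proof.
move=> p01 q01 mono; set h := q * _.
rewrite bernoulli_mean_union.
have -> : bernoulli_mean G p phi + h * \sum_(i in G)
     (bernoulli_mean G p (fun H => phi (i |: H)) - bernoulli_mean G p phi) =
  bernoulli_mean G p (fun A => phi A + h * \sum_(i in G) (phi (i |: A) + -1 * phi A)).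
  rewrite bernoulli_meanD bernoulli_meanZ bernoulli_mean_sum; congr (_ + _ * _).
  by apply: eq_bigr => i _; rewrite bernoulli_meanD bernoulli_meanZ mulN1r.
apply: bernoulli_mean_le => // A AG.
rewrite -lerBrDl -[X in _ - X](bernoulli_mean_cst G q (phi A)) -[- bernoulli_mean _ _ _]mulN1r.
rewrite -bernoulli_meanZ -bernoulli_meanD.
rewrite /bernoulli_mean (bigID (fun B => B \in finset.set1 @: G)) /=.
rewrite -[leLHS]addr0 lerD//; last first.
  apply: sumr_ge0 => B _; rewrite mulr_ge0 ?bernoulli_weight_ge0//.
  by rewrite mulN1r subr_ge0 mono// finset.subsetUl.
rewrite [leRHS](eq_bigl (mem (finset.set1 @: G))) => [|B] /=; last first.
  by rewrite andb_idl// => /imsetP[i iG ->]; rewrite finset.sub1set.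
rewrite big_imset /=; last by move=> i j _ _ /finset.set1_inj.
rewrite mulr_sumr; apply: ler_sum => i iG.
rewrite (bigD1 i)//= finset.set11 (eq_bigr (fun=> 1 - q)); last first.
  by move=> j /andP[_ ji]; rewrite inE (negPf ji).
rewrite prodr_const finset.setUC (_ : #|[pred j | _]| = #|G|.-1)//.
rewrite (cardsD1 i) iG /=; apply: eq_card => j.
by rewrite !inE andbC.
Qed.

Lemma bernoulli_mean_homo G p q phi : 0 <= p -> p <= q -> q <= 1 ->
  (forall A B, A \subset B -> phi A <= phi B) ->
  bernoulli_mean G p phi <= bernoulli_mean G q phi.
Proof.
move=> p0 pq q1 mono; have [p1|p1] := eqVneq p 1.
  by have -> : q = p by lra.
have p1' : p < 1 by rewrite lt_neqAle p1 (le_trans pq).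
pose s := (q - p) / (1 - p).
have s01 : 0 <= s <= 1.
  rewrite divr_ge0 ?subr_ge0 ?(le_trans pq)//= ler_pdivrMr ?subr_gt0// mul1r.
  by rewrite lerD2r.
have -> : q = p + s - p * s by rewrite /s; field; rewrite subr_eq0 eq_sym.
have p01 : 0 <= p <= 1 by rewrite p0 ltW.
apply: le_trans (bernoulli_mean_sprinkle G p01 s01 mono).
have /andP[s0 s1] := s01; move: s s0 s1 {s01} => s s0 s1.
rewrite lerDl mulr_ge0 ?mulr_ge0 ?exprn_ge0 ?subr_ge0//.
apply: sumr_ge0 => i _; rewrite subr_ge0 bernoulli_mean_le// => H _.
by rewrite mono// finset.subsetUr.
Qed.

End RandomSubset.

(** * Matchings of a random subhypergraph *)

Section Packing.
Variables (I X : finType) (F : I -> {set X}).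
Implicit Types (A B H M : {set I}) (U : {set X}).

Definition is_packing H U M : bool :=
  [&& M \subset H, [forall i in M, F i \subset U] &
      [forall i in M, forall j in M, (i != j) ==> [disjoint F i & F j]]].

(** The matching number of the edges with index in H that are contained in U. *)
Definition packing H U : nat := (\max_(M : {set I} | is_packing H U M) #|M|)%N.

Lemma packing_homo A B U : A \subset B -> (packing A U <= packing B U)%N.
Proof.
move=> AB; apply/bigmax_leqP => M /and3P[MA MU Md].
apply: (@leq_bigmax_cond _ _ (fun M : {set I} => #|M|)); apply/and3P.
by split=> //; apply: fintype.subset_trans AB.
Qed.

Lemma packing_attained H U : exists2 M, is_packing H U M & packing H U = #|M|.
Proof.
have P0 : is_packing H U finset.set0.
  apply/and3P; split; first exact: finset.sub0set.
    by apply/forall_inP => i; rewrite inE.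
  by apply/forall_inP => i; rewrite inE.
rewrite /packing (bigop.bigmax_eq_arg _ P0).
by case: arg_maxnP => // M PM _; exists M.
Qed.

Lemma packing_add H U i : F i \subset U -> F i != finset.set0 ->
  ((packing H (U :\: F i)).+1 <= packing (i |: H) U)%N.
Proof.
move=> iU i0.
have [M /and3P[MH /forall_inP MU /forall_inP Md] ->] := packing_attained H (U :\: F i).
have iM : i \notin M.
  apply/negP => /MU /fintype.subsetP sub; have /finset.set0Pn[x xi] := i0.
  by have := sub x xi; rewrite inE xi.
have Mdis j : j \in M -> [disjoint F i & F j].
  by move=> /MU; rewrite finset.subsetD disjoint_sym => /andP[].
rewrite -add1n (_ : 1 + _ = #|i |: M|)%N; last by rewrite cardsU1 iM.
apply: (@leq_bigmax_cond _ _ (fun M : {set I} => #|M|)); apply/and3P; split.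
- exact: finset.setUS.
- apply/forall_inP => j /finset.setU1P[->//|/MU].
  by rewrite finset.subsetD => /andP[].
- apply/forall_inP => j /finset.setU1P[->|jM]; apply/forall_inP => k /finset.setU1P[->|kM].
  + by rewrite eqxx.
  + by apply/implyP => _; apply: Mdis.
  + by apply/implyP => _; rewrite disjoint_sym; apply: Mdis.
  + by have /forall_inP := Md j jM; apply.
Qed.

Lemma packing_bound H U r : (forall i, i \in H -> #|F i| = r) ->
  (r * packing H U <= #|U|)%N.
Proof.
move=> Fr; have [M /and3P[MH /forall_inP MU /forall_inP Md] ->] := packing_attained H U.
have -> : (r * #|M| = \sum_(i in M) \sum_(x in U) (x \in F i))%N.
  rewrite mulnC -sum_nat_const; apply: eq_bigr => i iM.
  rewrite -(Fr i (fintype.subsetP MH i iM)) -sum1_card [RHS]big_mkcond /= [LHS]big_mkcond /=.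
  apply: eq_bigr => x _; case: ifP => [xi|_]; last by case: ifP.
  by rewrite (fintype.subsetP (MU i iM)).
rewrite exchange_big /= -sum1_card; apply: leq_sum => x xU.
have [i /andP[iM xi]|none] := pickP (fun i => (i \in M) && (x \in F i)); last first.
  by rewrite big1 // => i iM; have := none i; rewrite iM /= => ->.
rewrite (bigD1 i)//= big1 ?addn0 ?leq_b1// => j /andP[jM ji].
have /forall_inP/(_ _ jM) := Md i iM; rewrite eq_sym ji /= => dij.
by rewrite (disjointFr dij xi).
Qed.

End Packing.

Section GreedyPacking.
Variables (R : realFieldType) (I X : finType) (F : I -> {set X}).
Variables (G : {set I}) (D : {set X}) (r : nat).
Hypothesis FD : forall i, i \in G -> F i \subset D.
Hypothesis F_card : forall i, i \in G -> #|F i| = r.+1.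

Let W (p : R) (U : {set X}) : R :=
  bernoulli_mean G p (fun H => (packing F H U)%:R).

Let rate (q : R) : R := q * (1 - q) ^+ #|G|.-1.

(** An edge F i contained in U extends every matching inside U :\: F i. *)
Lemma packing_mean_step (p q : R) (U : {set X}) : 0 <= p <= 1 -> 0 <= q <= 1 ->
  greedy_step F G (rate q) (W p) U + rate q * #|[set i in G | F i \subset U]|%:R
    <= W (p + q - p * q) U.
Proof.
move=> p01 q01; set h := rate q; have /andP[q0 q1] := q01.
have h0 : 0 <= h by rewrite mulr_ge0 ?exprn_ge0 ?subr_ge0.
have mono (A B : {set I}) : A \subset B -> (packing F A U)%:R <= (packing F B U)%:R :> R.
  by move=> AB; rewrite ler_nat packing_homo.
apply: le_trans (bernoulli_mean_sprinkle G p01 q01 mono).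
rewrite /greedy_step -/h -/(W p U) -addrA lerD2l -mulrDr ler_wpM2l//.
rewrite -sum1dep_card natr_sum -big_split /= big_mkcondr /=.
apply: ler_sum => i iG; case: ifP => iU; last first.
  by rewrite subr_ge0 bernoulli_mean_le// => H _; rewrite mono// finset.subsetUr.
rewrite addrAC lerD2r addrC.
apply: (@le_trans _ _ (bernoulli_mean G p (fun H => 1 + (packing F H (U :\: F i))%:R))).
  by rewrite bernoulli_meanD bernoulli_mean_cst.
apply: bernoulli_mean_le => // H _.
by rewrite nat1r ler_nat packing_add// -cards_eq0 F_card.
Qed.

(** Per step, the mean of #|U :&: D| / (r+1) decreases by h times the number of
    edges contained in U, while by [packing_mean_step] the mean matching number
    gains as much; so the mean matching number minus this quantity dominates its
    own image under the transition operator. *)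
Lemma packing_mean_ge (q : R) K : 0 <= q <= 1 ->
  rate q * #|G|%:R <= 1 ->
  forall U, r.+1%:R^-1 * #|U :&: D|%:R
     + - r.+1%:R^-1 * \sum_(x in D) surv F G (rate q) K [set x] U
    <= W (1 - (1 - q) ^+ K) U.
Proof.
move=> q01; set h := rate q => hG; have /andP[q0 q1] := q01.
have h0 : 0 <= h by rewrite mulr_ge0 ?exprn_ge0 ?subr_ge0.
elim: K => [|K IH] U.
  rewrite expr0 subrr /= -natr_sum mulNr -mulrBr.
  rewrite (_ : \sum_(x in D) ([set x] \subset U) = #|U :&: D|)%N; last first.
    rewrite -sum1_card [RHS]big_mkcond /= big_mkcond /=; apply: eq_bigr => x _.
    by rewrite finset.sub1set inE andbC; case: (x \in D) => //=; case: (x \in U).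
  rewrite subrr mulr0; apply: sumr_ge0 => H _.
  by rewrite mulr_ge0// bernoulli_weight_ge0// lexx ler01.
have p01 : 0 <= 1 - (1 - q) ^+ K <= 1.
  by rewrite subr_ge0 exprn_ile1 ?subr_ge0// ?gerBl ?exprn_ge0 ?subr_ge0.
have -> : 1 - (1 - q) ^+ K.+1 = 1 - (1 - q) ^+ K + q - (1 - (1 - q) ^+ K) * q.
  by rewrite exprS; ring.
apply: le_trans (packing_mean_step U p01 q01); rewrite -/h.
have := @greedy_step_le R I X F G h (fun V => r.+1%:R^-1 * #|V :&: D|%:R
   + - r.+1%:R^-1 * \sum_(x in D) surv F G h K [set x] V) _ h0 hG IH U.
rewrite -(lerD2r (h * #|[set i in G | F i \subset U]|%:R)); apply: le_trans.
rewrite greedy_step_sum.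
have -> : greedy_step F G h (fun V => r.+1%:R^-1 * #|V :&: D|%:R) U =
    r.+1%:R^-1 * #|U :&: D|%:R - h * #|[set i in G | F i \subset U]|%:R.
  rewrite /greedy_step -[- (h * _)]mulrN -sum1dep_card natr_sum -sumrN; congr (_ + _ * _).
  apply: eq_bigr => i /andP[iG iU].
  have -> : #|U :&: D| = (r.+1 + #|(U :\: F i) :&: D|)%N.
    rewrite -(F_card iG) -(cardsID (F i) (U :&: D)); congr (_ + _)%N.
      apply: eq_card => x; rewrite !inE; case xi: (x \in F i); rewrite ?andbF//.
      by rewrite (fintype.subsetP iU)//= (fintype.subsetP (FD iG)).
    by apply: eq_card => x; rewrite !inE andbA.
  by rewrite natrD mulrDr mulVf ?pnatr_eq0// opprD addrCA subrr addr0.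
rewrite addrAC subrK lerD2l le_eqVlt; apply/orP; left.
by apply/eqP; congr (_ * _); apply: eq_bigr => x _; rewrite -surv_stepE.
Qed.

End GreedyPacking.

(** * Nearly perfect matchings of sparse random subhypergraphs *)

Section NearPerfect.
Variable R : archiRealFieldType.

(** Choose the number Q of stages so that f falls below delta / 2, ask for
    accuracy delta / 8 (which bounds the error by delta / 2 on singletons), and
    then take the number J of rounds per stage large in terms of the hypergraph.
    The density q of a round is kappa / (J d), where kappa = 12 / 16^(r+1) is
    the longest duration of a stage that [surv_stage] allows.  The total density
    is then at most Q kappa / d, which is below p when d p is large. *)
Lemma sparse_packing_mean (r : nat) (delta : R) : 0 < delta ->
  exists C : R, forall (I X : finType) (F : I -> {set X}) (G : {set I})
    (D : {set X}) (d : nat) (p : R),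
  regular_linear F G D r.+1 d -> 0 <= p <= 1 -> C <= d%:R * p ->
  (1 - delta) * (r.+1%:R^-1 * #|D|%:R)
    <= bernoulli_mean G p (fun H => (packing F H D)%:R).
Proof.
move=> delta0; pose kappa : R := 12 / 16 ^+ r.+1.
have pow0 : 0 < 16 ^+ r.+1 :> R by rewrite exprn_gt0.
have kappa0 : 0 < kappa by rewrite divr_gt0.
have kappa1 : kappa <= 1.
  rewrite ler_pdivrMr// mul1r exprS; have := exprn_ege1 r (ler1n R 16 : 1 <= 16 :> R).
  by lra.
have kappa16 : kappa * 16 ^+ r.+1 = 12 by rewrite divfK// gt_eqF.
clearbody kappa.
pose m := (delta / 2) ^+ r.+1.
have m0 : 0 < m by rewrite exprn_gt0 ?divr_gt0.
pose Q := Num.bound (2 / (kappa * m)).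
have Q1 : 1 <= Q%:R * (kappa / 2 * m).
  have : 2 / (kappa * m) < Q%:R.
    by apply: archi_boundP; rewrite divr_ge0 ?mulr_ge0 ?(ltW kappa0) ?(ltW m0).
  rewrite ltr_pdivrMr ?mulr_gt0// => /ltW; lra.
have e0 : 0 < delta / 8 by rewrite divr_gt0.
pose tau := tolerance Q (delta / 8).
have tau0 : 0 < tau by apply: tolerance_gt0.
exists (Num.max (Q%:R * kappa) (Num.max (2 / tau) 1)).
move=> I X F G D d p lin p01 Cdp.
have [FD F_card _ _] := lin.
have /andP[p0 p1] := p01.
have [Qp taud d1] : [/\ Q%:R * kappa <= d%:R * p, 2 / tau <= d%:R & 1 <= d%:R :> R].
  move: Cdp; rewrite !ge_max => /and3P[Qp taup dp1].
  have dp : d%:R * p <= d%:R by rewrite ler_piMr.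
  by split => //; apply: le_trans dp.
pose J := (Num.bound (2 * kappa / tau) + Num.bound (2 * kappa * #|G|%:R)).+1.
have [J1 Jtau JG] : [/\ 1 <= J%:R :> R, 2 * kappa / tau <= J%:R &
    2 * kappa * #|G|%:R <= J%:R].
  have b1 : 2 * kappa / tau < (Num.bound (2 * kappa / tau))%:R.
    by apply: archi_boundP; rewrite divr_ge0 ?mulr_ge0 ?(ltW kappa0) ?(ltW tau0).
  have b2 : 2 * kappa * #|G|%:R < (Num.bound (2 * kappa * #|G|%:R))%:R.
    by apply: archi_boundP; rewrite !mulr_ge0 ?(ltW kappa0)//.
  split; first by rewrite ler1n.
    by apply/ltW/(lt_le_trans b1); rewrite ler_nat leqW// leq_addr.
  by apply/ltW/(lt_le_trans b2); rewrite ler_nat leqW// leq_addl.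
have J0 : 0 < J%:R :> R by exact: lt_le_trans ltr01 J1.
have d0 : 0 < d%:R :> R by exact: lt_le_trans ltr01 d1.
(* Only these lower bounds on J matter from here on. *)
move: (J) J1 Jtau JG J0 => {}J J1 Jtau JG J0.
have Jd1 : 1 <= J%:R * d%:R :> R by apply: mulr_ege1.
pose q := kappa / (J%:R * d%:R).
have qJd : q * (J%:R * d%:R) = kappa by rewrite divfK// gt_eqF ?mulr_gt0.
have q0 : 0 <= q by rewrite divr_ge0 ?mulr_ge0 ?ltW.
have q1 : q <= 1 by rewrite ler_pdivrMr ?mulr_gt0// mul1r (le_trans kappa1).
have qG : q * #|G|%:R <= 1 / 2.
  rewrite mulrAC ler_pdivrMr ?mulr_gt0//.
  have : J%:R <= J%:R * d%:R :> R by rewrite ler_peMr// ltW.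
  by lra.
clearbody q.
pose h := q * (1 - q) ^+ #|G|.-1.
(* At least half of the rate q survives the restriction to rounds with a single edge. *)
have half : 1 / 2 <= (1 - q) ^+ #|G|.-1.
  apply: le_trans (bernoulli_ge _ _); last by lra.
  have : #|G|.-1%:R * q <= #|G|%:R * q by rewrite ler_wpM2r// ler_nat leq_pred.
  by lra.
have pow1 : (1 - q) ^+ #|G|.-1 <= 1 by rewrite exprn_ile1//; lra.
have hq : h <= q by rewrite ler_piMr.
have hq2 : q / 2 <= h by rewrite ler_wpM2l//; lra.
have h0 : 0 <= h by apply: le_trans hq2; lra.
have hG : h * #|G|%:R <= 1.
  by apply: le_trans (ler_wpM2r _ hq) _ => //; lra.
have Jt : J%:R * (h * d%:R) <= kappa.
  by rewrite -qJd mulrCA ler_wpM2r ?mulr_ge0 ?(ltW J0) ?(ltW d0).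
have Jt2 : kappa / 2 <= J%:R * (h * d%:R).
  have := ler_wpM2r (ltW (lt_le_trans ltr01 Jd1)) hq2.
  by rewrite mulrAC qJd; lra.
have t0 : 0 <= h * d%:R by rewrite mulr_ge0.
have tJ : h * d%:R <= J%:R * (h * d%:R) by rewrite ler_peMl.
have t1 : h * d%:R <= 1 by lra.
have tkJ : h * d%:R <= kappa / J%:R by rewrite ler_pdivlMr// mulrC.
have hd : h = h * d%:R / d%:R by rewrite mulfK// gt_eqF.
have J_short : J%:R * (h * d%:R * 16 ^+ r.+1) <= 12.
  by rewrite mulrA -kappa16 ler_pM2r.
have J_tol : J%:R * (h + (h * d%:R) ^+ 2) <= tau.
  rewrite {1}hd expr2 -mulrDr mulrA.
  have s0 : d%:R^-1 + h * d%:R <= tau.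
    have : d%:R^-1 <= tau / 2.
      by rewrite -[tau / 2]invrK lef_pV2 ?posrE ?invr_gt0 ?divr_gt0// invf_div.
    have : kappa / J%:R <= tau / 2.
      by move: Jtau; rewrite ler_pdivrMr// ler_pdivrMr//; lra.
    by lra.
  apply: le_trans (ler_wpM2l _ s0) _; first by rewrite mulr_ge0 ?(ltW J0).
  by rewrite ler_piMl ?(ltW tau0)// (le_trans Jt).
set K := (Q * J)%N.
have small : decay r (h * d%:R) K <= delta / 2.
  apply: decay_small; [by rewrite t0|by rewrite divr_ge0// ltW|].
  apply: (le_trans Q1); rewrite -/m /K natrM -[leRHS]mulrA ler_wpM2l//.
  by rewrite [leRHS]mulrA ler_wpM2r ?(ltW m0).
have unmatched x : x \in D -> surv F G h K [set x] D <= delta.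
  move=> xD; have xD' : [set x] \subset D by rewrite finset.sub1set.
  have := surv_approx lin h0 hG t1 J_short e0 J_tol xD'.
  rewrite finset.cards1 !expr1 ler_norml; lra.
have Kq : 1 - (1 - q) ^+ K <= p.
  have : 1 + K%:R * (- q) <= (1 - q) ^+ K by apply: bernoulli_ge; lra.
  have : K%:R * q <= p; last by lra.
  rewrite -(ler_pM2l d0); apply: le_trans Qp.
  by rewrite /K natrM -qJd; lra.
have q01 : 0 <= q <= 1 by rewrite q0.
have := packing_mean_ge FD F_card K q01 hG D.
rewrite finset.setIid => le.
apply: (@le_trans _ _ (bernoulli_mean G (1 - (1 - q) ^+ K)
    (fun H => (packing F H D)%:R))); last first.
  apply: bernoulli_mean_homo => //.
    by rewrite subr_ge0 exprn_ile1; lra.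
  by move=> A B AB; rewrite ler_nat packing_homo.
apply: le_trans le; rewrite mulrBl mul1r mulNr lerD2l lerN2 mulrCA ler_wpM2l//.
apply: (@le_trans _ _ (\sum_(x in D) delta)); first exact: ler_sum.
by rewrite sumr_const mulr_natr.
Qed.

End NearPerfect.

(** * The hypergraph of facets *)

Section Facets.
Variables (T : finType) (k : nat).

Definition k_subsets (m : nat) : {set {set T}} := [set s : {set T} | #|s| == m].

Definition facets (e : {set T}) : {set {set T}} :=
  [set s : {set T} | (s \subset e) && (#|s| == k)].

Lemma is_rgraph_sub (r : nat) (H : {set {set T}}) :
  is_rgraph r H = (H \subset k_subsets r).
Proof.
by apply/forall_inP/fintype.subsetP => Hr e /Hr; rewrite inE.
Qed.

Lemma card_facets (e : {set T}) : #|facets e| = 'C(#|e|, k).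
Proof. exact: cards_draws. Qed.

Lemma facetsI (e f : {set T}) : facets e :&: facets f = facets (e :&: f).
Proof.
by apply/setP => s; rewrite !inE finset.subsetI andbACA andbb.
Qed.

(** This turns (r-1)-matchings of r-graphs into matchings of the facet
    hypergraph. *)
Lemma disjoint_facets (e f : {set T}) :
  [disjoint facets e & facets f] = (#|e :&: f| < k)%N.
Proof.
by rewrite -finset.setI_eq0 facetsI -cards_eq0 card_facets eqn0Ngt bin_gt0 -ltnNge.
Qed.

Lemma facets_degree (s : {set T}) : s \in k_subsets k ->
  #|[set e in k_subsets k.+1 | s \in facets e]| = (#|T| - k)%N.
Proof.
rewrite inE => /eqP sk.
have -> : (#|T| - k = #|~: s|)%N by rewrite [RHS]cardsCs finset.setCK sk.
rewrite -(card_in_imset (f := fun x => x |: s) (D := ~: s)).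
  congr #|pred_of_set _|; apply/setP => e; rewrite !inE sk eqxx andbT.
  apply/andP/imsetP => [[/eqP ek se]|[x]].
    have /eqP/cards1P[x xE] : #|e :\: s| = 1%N.
      by rewrite cardsD (finset.setIidPr se) ek sk subSnn.
    have : x \in e :\: s by rewrite xE finset.set11.
    rewrite inE => /andP[xs xe]; exists x; first by rewrite inE.
    by rewrite -(finset.setID e s) (finset.setIidPr se) xE finset.setUC.
  rewrite inE => xs ->; split; last exact: finset.subsetUr.
  by rewrite cardsU1 xs sk.
move=> x y; rewrite !inE => xs ys. move=> /setP/(_ x).
by rewrite !inE eqxx (negPf xs) orbF => /esym; rewrite orbF => /eqP.
Qed.

Lemma facets_codegree (s u : {set T}) :
  s \in k_subsets k -> u \in k_subsets k -> s != u ->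
  (#|[set e in k_subsets k.+1 | (s \in facets e) && (u \in facets e)]| <= 1)%N.
Proof.
rewrite !inE => /eqP sk /eqP uk su.
have big : (k < #|s :|: u|)%N.
  rewrite -sk; apply: proper_card; rewrite finset.properEneq finset.subsetUl andbT.
  apply: contra su => /eqP sE; rewrite eq_sym eqEcard sk uk leqnn andbT.
  by rewrite sE finset.subsetUr.
rewrite -(cards1 (s :|: u)); apply/subset_leq_card/fintype.subsetP => e.
rewrite !inE => /and3P[/eqP ek /andP[se _] /andP[ue _]].
by rewrite eq_sym eqEcard finset.subUset se ue ek.
Qed.

Lemma facets_regular_linear :
  regular_linear facets (k_subsets k.+1) (k_subsets k) k.+1 (#|T| - k).
Proof.
split.
- by move=> e _; apply/fintype.subsetP => s; rewrite !inE => /andP[].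
- by move=> e; rewrite inE card_facets => /eqP ->; rewrite binSn.
- exact: facets_degree.
- exact: facets_codegree.
Qed.

Lemma nu_packing (H : {set {set T}}) : H \subset k_subsets k.+1 ->
  nu k H = packing facets H (k_subsets k).
Proof.
move=> HG; apply: eq_bigl => M; rewrite /is_matching /is_packing.
rewrite (_ : [forall e in M, facets e \subset k_subsets k]); last first.
  apply/forall_inP => e _; apply/fintype.subsetP => s.
  by rewrite !inE => /andP[].
congr (_ && _); apply: eq_forallb_in => e _; apply: eq_forallb_in => f _.
by rewrite disjoint_facets.
Qed.

End Facets.

(** * The random r-graph *)

Lemma Hrnp_probE (R : realType) (r n : nat) (p : R) (A : pred {set {set 'I_n}}) :
  Hrnp_prob r p A = bernoulli_mean (k_subsets 'I_n r) p (fun H => (A H)%:R).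
Proof.
rewrite /Hrnp_prob /bernoulli_mean big_mkcondr /=.
apply: eq_big => [H|H _]; first exact: is_rgraph_sub.
case: (A H); last by rewrite mulr0.
by rewrite mulr1; apply: eq_bigl => e; rewrite inE.
Qed.

(** Markov's inequality for the nonnegative deficit B - phi. *)
Lemma bernoulli_mean_markov (R : realFieldType) (I : finType) (G : {set I})
    (p eps B : R) (phi : {set I} -> R) :
  0 <= p <= 1 -> 0 < eps -> 0 < B -> (forall H : {set I}, H \subset G -> phi H <= B) ->
  1 - (1 - bernoulli_mean G p phi / B) / eps <=
  bernoulli_mean G p (fun H => (`|phi H - B| <= eps * B)%R%:R).
Proof.
move=> p01 eps0 B0 phiB.
have epsn : eps != 0 by rewrite gt_eqF.
have Bn : B != 0 by rewrite gt_eqF.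
have -> : 1 - (1 - bernoulli_mean G p phi / B) / eps =
    bernoulli_mean G p (fun H => 1 - eps^-1 + (eps * B)^-1 * phi H).
  rewrite bernoulli_meanD bernoulli_meanZ bernoulli_mean_cst.
  by field; rewrite epsn Bn.
apply: bernoulli_mean_le => // H HG.
have le := phiB H HG; rewrite ler0_norm ?subr_le0// opprB.
have -> : 1 - eps^-1 + (eps * B)^-1 * phi H = 1 - (B - phi H) / (eps * B).
  by field; rewrite epsn Bn.
case: (boolP (B - phi H <= eps * B)) => far.
  by rewrite lerBlDr lerDl divr_ge0 ?subr_ge0// mulr_ge0 ?ltW.
by rewrite subr_le0 ler_pdivlMr ?mulr_gt0// mul1r ltW// ltNge.
Qed.

Theorem theorem1p10 (R : realType) (r : nat) (p : nat -> R) :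
  (3 <= r)%N ->
  (forall n, 0 <= p n <= 1) ->
  ((n%:R - (r%:R - 1)) * p n @[n --> \oo] --> +oo)%classic ->
  whp_sim r p
    (fun n H => (nu r.-1 H)%:R)
    (fun n => r%:R^-1 * 'C(n, r.-1)%:R).
Proof.
case: r => // k _ p01 dp; rewrite /whp_sim /whp succnK.
pose G n := k_subsets 'I_n k.+1; pose D n := k_subsets 'I_n k.
pose B n : R := k.+1%:R^-1 * 'C(n, k)%:R.
have cardD n : #|D n| = 'C(n, k).
  rewrite -[in RHS](card_ord n) -cardsT -cards_draws.
  by apply: eq_card => s; rewrite !inE finset.subsetT.
pose mean n := bernoulli_mean (G n) (p n) (fun H => (nu k H)%:R).
have nuB n (H : {set {set 'I_n}}) : H \subset G n -> (nu k H)%:R <= B n.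
  move=> HG; rewrite /B ler_pdivlMl ?ltr0n// -natrM ler_nat -cardD nu_packing//.
  have [_ Fc _ _] := facets_regular_linear 'I_n k.
  by apply: packing_bound => e /(fintype.subsetP HG); apply: Fc.
pose x n : R := 1 - mean n / B n.
have x0 : (x n @[n --> \oo] --> (0 : R))%classic.
  apply/cvgr0Pnorm_le => delta delta0.
  have [C PC] := sparse_packing_mean k delta0.
  near=> n.
  have kn : (k <= n)%N by near: n; apply: nbhs_infty_ge.
  have Bn0 : 0 < B n by rewrite mulr_gt0 ?invr_gt0 ?ltr0n ?bin_gt0.
  have Cdp : C <= (#|'I_n| - k)%:R * p n.
    rewrite card_ord natrB//.
    suff : C <= (n%:R - (k.+1%:R - 1)) * p n by rewrite -natr1 addrK.
    by near: n; move/cvgryPge: dp => /(_ C).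
  have := PC _ _ _ _ _ _ _ (facets_regular_linear 'I_n k) (p01 n) Cdp.
  rewrite cardD -/(B n) => le.
  have meanE : mean n = bernoulli_mean (G n) (p n)
      (fun H => (packing (@facets 'I_n k) H (D n))%:R).
    by apply: eq_bigr => H HG; rewrite nu_packing.
  have mB : mean n <= B n.
    rewrite -[leRHS](bernoulli_mean_cst (G n) (p n)).
    by apply: bernoulli_mean_le => // H /nuB.
  rewrite ger0_norm /x ?subr_ge0 ?ler_pdivrMr ?mul1r// lerBlDr -lerBlDl.
  by rewrite ler_pdivlMr// meanE.
(* The square root balances the width of the window against the failure
   probability x n / eps n; the harmonic term keeps the width positive. *)
pose eps n : R := Num.sqrt `|x n| + n.+1%:R^-1.
have sx0 : (Num.sqrt `|x n| @[n --> \oo] --> (0 : R))%classic.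
  have : (`|x n| @[n --> \oo] --> (0 : R))%classic by rewrite -(normr0 R); apply: cvg_norm.
  move=> /(@continuous_cvg _ _ _ _ _ _ Num.sqrt 0 (@sqrt_continuous R 0)).
  by rewrite sqrtr0.
exists eps.
  by rewrite -[X in (_ --> X)%classic]addr0; apply: cvgD => //; apply: cvg_harmonic.
have eps0 n : 0 < eps n by rewrite ltr_wpDl ?sqrtr_ge0 ?invr_gt0 ?ltr0n.
apply: (@squeeze_cvgr _ _ _ _ (fun n => 1 - Num.sqrt `|x n|) (fun=> 1)).
- near=> n; rewrite Hrnp_probE; apply/andP; split; last first.
    rewrite -[leRHS](bernoulli_mean_cst (G n) (p n)).
    by apply: bernoulli_mean_le => // H _; rewrite lern1 leq_b1.
  have kn : (k <= n)%N by near: n; apply: nbhs_infty_ge.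
  have Bn0 : 0 < B n by rewrite mulr_gt0 ?invr_gt0 ?ltr0n ?bin_gt0.
  apply: le_trans (bernoulli_mean_markov (p01 n) (eps0 n) Bn0 (@nuB n)).
  rewrite lerD2l lerN2 ler_pdivrMr// -/(mean n) -/(x n).
  apply: (le_trans (ler_norm _)); rewrite -[leLHS]sqr_sqrtr// expr2.
  by rewrite ler_wpM2l ?sqrtr_ge0// lerDl invr_ge0.
- by rewrite -[X in (_ --> X)%classic]subr0; apply: cvgB => //; apply: cvg_cst.
- exact: cvg_cst.
Unshelve. all: by end_near.
Qed.
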